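(* Let $n$ be a positive integer. Then $$\sum_{k_1 \ge \dots \ge k_n \ge 0} R^{\ast}_{(k_{1},\ldots,k_{n})}(x_{1},\ldots,x_{n};1,1,w)= (-1)^n \prod_{i=1}^{n} x_i^{-1} \sum_{0 \le k_1 < \dots < k_n} R^{\ast}_{(k_{1},\ldots,k_{n})}(x_{1}^{-1},\ldots,x_{n}^{-1};1,1,w),$$ as an identity of rational functions: the power series $\sum_{0 \le k_1 < \dots < k_n} R^{\ast}_{(k_{1},\ldots,k_{n})}(x_{1},\ldots,x_{n};1,1,w)$ and $\sum_{k_1 \ge \dots \ge k_n \ge 0} R^{\ast}_{(k_{1},\ldots,k_{n})}(x_{1},\ldots,x_{n};1,1,w)$ are expansions of rational functions $F(x_1,\dots,x_n)$ and $G(x_1,\dots,x_n)$, respectively, and $G(x_1,\dots,x_n)=(-1)^n\prod_{i=1}^n x_i^{-1}\, F(x_1^{-1},\dots,x_n^{-1})$.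
   Context: For a sequence of integers $\boldsymbol{k}=(k_1,\dots,k_n)$ (not necessarily increasing), the modified Robbins polynomial is $$R_{\boldsymbol{k}}^{\ast}(x_{1},\ldots,x_{n};u,v,w)=\frac{\mathbf{ASym}_{x_{1},\ldots,x_{n}}\left[\prod_{1\le i<j\le n}(u x_{i}x_{j}+v+w x_{i})\prod_{i=1}^{n}x_{i}^{k_{i}}\right]}{\prod_{1\le i<j\le n}(x_{j}-x_{i})},$$ where $\mathbf{ASym}_{x_1,\ldots,x_n} F(x_1,\dots,x_n)=\sum_{\sigma\in\mathfrak S_n}\operatorname{sgn}(\sigma)F(x_{\sigma(1)},\dots,x_{\sigma(n)})$. The variables $x_1,\dots,x_n,w$ are indeterminates; the infinite sums are formal power series in $x_1,\dots,x_n$ (the $k_i$ range over nonnegative integers satisfying the displayed inequalities). *)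

(* Defs.v *)
From HB Require Import structures.
From mathcomp Require Import all_boot all_order all_fingroup all_algebra.
From mathcomp.multinomials Require Import mpoly.

Set Implicit Arguments.
Unset Strict Implicit.
Unset Printing Implicit Defensive.

Import Order.TTheory GRing.Theory Num.Theory.
Local Open Scope ring_scope.

Definition asym (K : fieldType) (n : nat) (f : ('I_n -> K) -> K)
    (x : 'I_n -> K) : K :=
  \sum_(s : 'S_n) (-1) ^+ s * f (x \o s).

(* The defining quotient is evaluated at a point x of a field K.  With K a field
   of rational functions and x its generators, this is the rational function
   itself.  Exponents are integers, so negative k i are allowed. *)
Definition robbins (K : fieldType) (n : nat) (k : {ffun 'I_n -> int})
    (x : 'I_n -> K) (u v w : K) : K :=
  asym (fun y : 'I_n -> K =>
          (\prod_(i < n) \prod_(j < n | (i < j)%N)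
              (u * y i * y j + v + w * y i))
          * \prod_(i < n) y i ^ k i) x
  / \prod_(i < n) \prod_(j < n | (i < j)%N) (x j - x i).

Section RationalFunctions.
Variables (A : idomainType) (n : nat).

Definition ratfun : fieldType := {fraction {mpoly A[n]}}.

Definition ratC (c : A) : ratfun := FracField.tofrac (c%:MP_[n]).
Definition ratX (i : 'I_n) : ratfun := FracField.tofrac ('X_i : {mpoly A[n]}).

(* F(y_1, ..., y_n), read off the representative fraction chosen by the quotient.
   The value does not depend on this choice when no nonzero polynomial vanishes
   at y, for instance when the y i are the inverses of the variables; it is a
   junk value if the denominator vanishes at y. *)
Definition ratfun_subst (F : ratfun) (y : 'I_n -> ratfun) : ratfun :=
  let r : {ratio {mpoly A[n]}} := generic_quotient.repr (F : {fraction {mpoly A[n]}}) in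
  mmap ratC y \n_r / mmap ratC y \d_r.

(* Formal power series over A in n variables, as coefficient functions. *)
Definition pseries := 'X_{1..n} -> A.

Definition mul_mpoly_pseries (q : {mpoly A[n]}) (f : pseries) : pseries :=
  fun m => \sum_(j <- msupp q | (j <= m)%MM) q@_j * f (m - j)%MM.

(* f is the expansion at the origin of the rational function r = p / q.  Since
   A is a domain, q * f = p has at most one solution f, and f determines r. *)
Definition is_expansion (r : ratfun) (f : pseries) : Prop :=
  exists p q : {mpoly A[n]},
    [/\ q@_0%MM != 0,
        r = FracField.tofrac p / FracField.tofrac q
      & forall m, mul_mpoly_pseries q f m = p@_m].

(* The family (g i), for i satisfying P, is summable with sum f: in each degree m
   only finitely many members contribute. *)
Definition is_pseries_sum (I : eqType) (P : pred I) (g : I -> pseries)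
    (f : pseries) : Prop :=
  forall m, exists s : seq I,
    [/\ uniq s,
        {in s, forall i, P i},
        (forall i, P i -> i \notin s -> g i m = 0)
      & f m = \sum_(i <- s) g i m].

(* The sum of the r i, for i satisfying P, taken in the ring of formal power
   series, is the expansion of the rational function F. *)
Definition sum_is_expansion_of (I : eqType) (P : pred I) (r : I -> ratfun)
    (F : ratfun) : Prop :=
  exists (g : I -> pseries) (f : pseries),
    [/\ forall i, P i -> is_expansion (r i) (g i),
        is_pseries_sum P g f
      & is_expansion F f].

End RationalFunctions.

Arguments ratX A {n} i.

(* 0 <= k_1 < ... < k_n *)
Definition strict_incr_nonneg (n : nat) (k : {ffun 'I_n -> int}) : bool :=
  [forall i, 0 <= k i] && [forall i : 'I_n, forall j : 'I_n, (i < j)%N ==> (k i < k j)].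

(* k_1 >= ... >= k_n >= 0 *)
Definition weak_decr_nonneg (n : nat) (k : {ffun 'I_n -> int}) : bool :=
  [forall i, 0 <= k i] && [forall i : 'I_n, forall j : 'I_n, (i < j)%N ==> (k j <= k i)].

(* The scalars are Z[w], with w the variable of {poly int}, so that the identity
   lives in the field of rational functions in x_1, ..., x_n, w. *)
Definition robbins11w (n : nat) (k : {ffun 'I_n -> int}) : ratfun {poly int} n :=
  robbins k (ratX {poly int}) 1 1 (ratC n 'X).

(* Main.v *)
Require Import Defs.
From HB Require Import structures.
From mathcomp Require Import all_boot all_order all_fingroup all_algebra ring zify.
From mathcomp.multinomials Require Import mpoly.

Set Implicit Arguments.
Unset Strict Implicit.
Unset Printing Implicit Defensive.

Import Order.TTheory GRing.Theory Num.Theory.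
Local Open Scope ring_scope.

(** Write R_k = Sym(M x^k), where M is the product over i < j of
    (x_i x_j + 1 + w x_i) and Sym sends E(x) to ASym E / prod_(i<j) (x_j - x_i),
    that is, to the sum over permutations s of E(x o s) / V(x o s), V being the
    Vandermonde product.  Sym is linear, so summing R_k over k amounts to summing
    the geometric series of the monomials x^k inside Sym:
      - over 0 <= k_1 < ... < k_n one gets
        E_F(x) = M(x) prod_i x_i^(i-1) / prod_j (1 - x_j x_(j+1) ... x_n);
      - over k_1 >= ... >= k_n >= 0 one gets
        E_G(x) = M(x) / prod_j (1 - x_1 x_2 ... x_j).
    Put F = Sym E_F and G = Sym E_G.  Replacing every x_i by its inverse in one
    term E_F / V of F gives, up to the factor (-1)^n prod_i x_i, the term E_G / V
    at the reversed variables (x_n, ..., x_1): M and V both become their reversals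
    divided by prod_(i<j) x_i x_j, and every factor 1 - U of the denominator turns
    into -(1 - U) / U.  This is [incr_term_inv].  The permutations in Sym absorb
    the reversal ([sum_incr_term_inv]), and the asserted identity follows.

    The analytic content is that F and G really are the sums of the series
    ([sum_kseq_expansion]).  Three facts are behind it.  Alternants of polynomials
    are divisible by V ([vdm_dvd_alternant]), so that Sym acts on polynomials and
    commutes with products by symmetric ones.  Division by V lowers the order of
    vanishing at the origin by a bounded amount ([low_symmetrize]), so that only
    finitely many k contribute in a given degree.  Lastly, the product of the
    geometric denominator over all permutations of the variables is symmetric with
    constant term 1, so it is a common denominator invertible at the origin.
    Substituting inverses in a fraction of polynomials is meaningful because no
    nonzero polynomial vanishes at the inverses of the variables
    ([mmap_inv_neq0]). *)

(** * Vandermonde products and evaluation of polynomials *)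

Definition vandermonde (R : comNzRingType) (n : nat) (x : 'I_n -> R) : R :=
  \prod_(i < n) \prod_(j < n | (i < j)%N) (x j - x i).

Lemma vandermonde_perm (R : comNzRingType) (n : nat) (x : 'I_n -> R) (s : 'S_n) :
  vandermonde (x \o s) = (-1) ^+ s * vandermonde x.
Proof.
pose V (y : 'I_n -> R) := Vandermonde n (\row_i y i).
have detV (y : 'I_n -> R) : vandermonde y = \det (V y).
  rewrite det_Vandermonde; apply: eq_bigr => i _; apply: eq_bigr => j _.
  by rewrite !mxE.
have colV : V (x \o s) = col_perm s (V x) by apply/matrixP => i j; rewrite !mxE.
by rewrite !detV colV col_permE det_mulmx det_perm odd_permV mulrC.
Qed.

Lemma rmorph_vandermonde (R S : comNzRingType) (phi : {rmorphism R -> S}) (n : nat)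
    (x : 'I_n -> R) :
  phi (vandermonde x) = vandermonde (phi \o x).
Proof.
rewrite rmorph_prod; apply: eq_bigr => i _.
by rewrite rmorph_prod; apply: eq_bigr => j _; rewrite rmorphB.
Qed.

(** This makes [mmap] the normal form of every ring morphism out of polynomials, so
    morphisms can be compared on constants and variables. *)
Lemma rmorph_mmap (A S : comNzRingType) (n : nat)
    (phi : {rmorphism {mpoly A[n]} -> S}) (p : {mpoly A[n]}) :
  phi p = mmap (phi \o @mpolyC n A) (fun i => phi 'X_i) p.
Proof.
rewrite {1}[p]mpolyE rmorph_sum; apply: eq_bigr => m _ /=.
rewrite -mul_mpolyC rmorphM mpolyXE_id rmorph_prod; congr (_ * _).
by apply: eq_bigr => i _; rewrite rmorphXn.
Qed.

Lemma mmap_msym (A S : comNzRingType) (n : nat) (f : {rmorphism A -> S})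
    (y : 'I_n -> S) (s : 'S_n) (p : {mpoly A[n]}) :
  mmap f y (msym s p) = mmap f (y \o s) p.
Proof.
rewrite [LHS](rmorph_mmap (mmap f y \o msym s)) {2}/mmap.
apply: eq_bigr => m _ /=; congr (_ * _); first by rewrite /msym mmapC /= mmapC.
apply: eq_bigr => i _ /=.
by rewrite /msym mmapX mmap1U mmapX mmap1U.
Qed.

(** * Exact division of alternants by the Vandermonde product *)

Section Alternants.
Variables (A : idomainType) (n : nat).
Implicit Types (p q : {mpoly A[n]}) (s : 'S_n) (i j : 'I_n).

Let X : 'I_n -> {mpoly A[n]} := fun i => 'X_i.

Definition vdm : {mpoly A[n]} := vandermonde X.

Lemma mmap_vdm (S : comNzRingType) (f : {rmorphism A -> S}) (y : 'I_n -> S) :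
  mmap f y vdm = vandermonde y.
Proof.
rewrite rmorph_vandermonde; apply: eq_bigr => i _; apply: eq_bigr => j _ /=.
by rewrite !mmapX !mmap1U.
Qed.

Lemma mpolyU_inj : injective X.
Proof.
move=> i j /mpolyP /(_ U_(j)%MM); rewrite !mcoeffXU eqxx.
by case: eqP => // _ /eqP; rewrite eq_sym oner_eq0.
Qed.

Lemma vdm_neq0 : vdm != 0.
Proof.
apply/prodf_neq0 => i _; apply/prodf_neq0 => j lt_ij.
by rewrite subr_eq0 (inj_eq mpolyU_inj) eq_sym -val_eqE neq_ltn lt_ij.
Qed.

Definition alternant p : {mpoly A[n]} := \sum_(s : 'S_n) (-1) ^+ s * msym s p.

Lemma alternantD p q : alternant (p + q) = alternant p + alternant q.
Proof.
by rewrite -big_split; apply: eq_bigr => s _; rewrite msymD mulrDr.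
Qed.

Lemma alternant_symM q p :
  (forall s, msym s q = q) -> alternant (q * p) = q * alternant p.
Proof.
by move=> symq; rewrite mulr_sumr; apply: eq_bigr => s _; rewrite msymM symq mulrCA.
Qed.

(** The kernel of this substitution of 'X_i for 'X_j is the ideal generated by
    'X_j - 'X_i ([collapse_dvd]); its image is a domain, so this ideal is prime. *)
Definition collapse i j : {mpoly A[n]} -> {mpoly A[n]} :=
  mmap (@mpolyC n A) (fun k => 'X_(if k == j then i else k)).

HB.instance Definition _ i j := GRing.RMorphism.copy (collapse i j)
  (mmap (@mpolyC n A) (fun k => 'X_(if k == j then i else k))).

Lemma collapseX i j k : collapse i j 'X_k = 'X_(if k == j then i else k).
Proof. by rewrite /collapse mmapX mmap1U. Qed.

(** The polynomials with this property contain the constants and the variables and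
    are stable under sum and product. *)
Lemma collapse_dvd i j p : exists q, p = collapse i j p + ('X_j - 'X_i) * q.
Proof.
pose D r := exists q, r = collapse i j r + ('X_j - 'X_i) * q.
have dvdD p1 p2 : D p1 -> D p2 -> D (p1 + p2).
  move=> [q1 e1] [q2 e2]; exists (q1 + q2).
  by rewrite {1}e1 {1}e2 rmorphD mulrDr addrACA.
have dvdM p1 p2 : D p1 -> D p2 -> D (p1 * p2).
  move=> [q1 e1] [q2 e2]; exists (q1 * p2 + collapse i j p1 * q2).
  rewrite {1}e1 mulrDl {1}e2 rmorphM !mulrDr !mulrA -!addrA; congr (_ + _).
  by rewrite addrC [_ * collapse i j p1]mulrC.
have dvdC c : D c%:MP by exists 0; rewrite /collapse mmapC mulr0 addr0.
rewrite -/(D p) [p]mpolyE; apply: (big_ind D (dvdC 0) dvdD) => m _.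
rewrite -mul_mpolyC; apply: (dvdM) => //; rewrite mpolyXE_id.
apply: (big_ind D (dvdC 1) dvdM) => k _.
elim: (m k) => [|e IHe]; first exact: (dvdC 1).
rewrite exprS; apply: dvdM IHe; rewrite /D collapseX.
case: eqP => [->|_]; last by exists 0; rewrite mulr0 addr0.
by exists 1; rewrite mulr1 addrC subrK.
Qed.

(** The transposition of i and j pairs the even permutations with the odd ones and
    paired terms agree after the substitution.  Cancelling the pairs, instead of
    deducing it from x = - x, is valid in every characteristic. *)
Lemma collapse_alternant i j p : i != j -> collapse i j (alternant p) = 0.
Proof.
move=> ne_ij; rewrite /alternant rmorph_sum /=.
pose t := tperm i j; have oddMt s : (s * t)%g = ~~ s :> bool.
  by rewrite odd_permM odd_tperm ne_ij addbT.
have collapse_t s : collapse i j (msym (s * t)%g p) = collapse i j (msym s p).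
  rewrite /collapse !mmap_msym /mmap; apply: eq_bigr => m _; congr (_ * _).
  apply: eq_bigr => k _ /=; rewrite permM /t.
  by case: tpermP => [->|->|]; rewrite ?eqxx ?(negPf ne_ij).
rewrite (bigID (@odd_perm _)) /=; apply: canLR (subrK _) _; rewrite add0r -sumrN.
rewrite (reindex_inj (mulIg t)); apply: eq_big => [s|s odds]; rewrite oddMt //.
rewrite !rmorphM !rmorph_sign /= collapse_t -mulNr; congr (_ * _).
by move: odds; rewrite oddMt; case: (odd_perm s).
Qed.

(** The factors 'X_j - 'X_i are split off one at a time: each one generates a prime
    ideal that contains the alternant but none of the other factors, hence it
    divides the cofactor reached so far. *)
Lemma vdm_dvd_alternant p : exists q, alternant p == vdm * q.
Proof.
rewrite /vdm /vandermonde (pair_big_dep predT (fun i j => (i < j)%N)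
  (fun i j => X j - X i)) /= -big_filter.
set l := [seq _ <- _ | _].
have lP ij : ij \in l -> (ij.1 < ij.2)%N by rewrite mem_filter => /andP[].
have: uniq l by rewrite filter_uniq // index_enum_uniq.
elim: l lP => [|[i j] l IHl] lP /=; first by exists (alternant p); rewrite big_nil mul1r.
case/andP=> ij_notin /IHl[ij' ij'_in|q /eqP defq].
  by apply: lP; rewrite in_cons ij'_in orbT.
have lt_ij : (i < j)%N by apply: (lP (i, j)); rewrite mem_head.
have ne_ij : i != j by rewrite -val_eqE neq_ltn lt_ij.
have: collapse i j (alternant p) == 0 by rewrite collapse_alternant.
rewrite defq rmorphM mulf_eq0 => /orP[|/eqP q0].
  rewrite rmorph_prod prodf_seq_eq0 => /hasP[[a b] ab_in /=].
  have lt_ab : (a < b)%N by apply: (lP (a, b)); rewrite in_cons ab_in orbT.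
  have ne_ab : (a, b) != (i, j) by apply: contraNneq ij_notin => <-.
  rewrite rmorphB /= !collapseX subr_eq0 (inj_eq mpolyU_inj).
  move: ne_ab lt_ij lt_ab; rewrite xpair_eqE.
  case: (eqVneq b j) => [->|ne_b]; case: (eqVneq a j) => [->|ne_a]; rewrite ?andbT ?ltnn //.
  - by move=> /negPf ne_ai _ _; rewrite eq_sym ne_ai.
  - by move=> _ lt_ij lt_jb /eqP eq_b; move: (ltn_trans lt_ij lt_jb); rewrite eq_b ltnn.
  - by move=> _ _ lt_ab /eqP eq_ab; move: lt_ab; rewrite eq_ab ltnn.
have [r defr] := collapse_dvd i j q; exists r.
by rewrite big_cons defr -/(collapse i j q) [collapse i j q]q0 add0r mulrCA mulrA.
Qed.

Definition symmetrize p : {mpoly A[n]} := xchoose (vdm_dvd_alternant p).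

Lemma symmetrizeE p : alternant p = vdm * symmetrize p.
Proof. exact/eqP/(xchooseP (vdm_dvd_alternant p)). Qed.

Lemma symmetrize_inj p q : vdm * p = vdm * q -> p = q.
Proof. exact: (mulfI vdm_neq0). Qed.

Lemma symmetrizeD p q : symmetrize (p + q) = symmetrize p + symmetrize q.
Proof. by apply: symmetrize_inj; rewrite mulrDr -!symmetrizeE alternantD. Qed.

Lemma symmetrize_symM q p :
  (forall s, msym s q = q) -> symmetrize (q * p) = q * symmetrize p.
Proof.
by move=> symq; apply: symmetrize_inj; rewrite mulrCA -!symmetrizeE alternant_symM.
Qed.

Lemma symmetrize0 : symmetrize 0 = 0.
Proof.
by apply: symmetrize_inj; rewrite mulr0 -symmetrizeE /alternant big1 // => s _; rewrite msym0 mulr0.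
Qed.

Lemma symmetrize_sum (I : Type) (r : seq I) (P : pred I) (F : I -> {mpoly A[n]}) :
  symmetrize (\sum_(i <- r | P i) F i) = \sum_(i <- r | P i) symmetrize (F i).
Proof. exact: (big_morph symmetrize symmetrizeD symmetrize0). Qed.

(** Order of vanishing at the origin at least d. *)
Definition low (d : nat) p := forall m, m \in msupp p -> (d <= mdeg m)%N.

Lemma low_coeff d p m : low d p -> (mdeg m < d)%N -> p@_m = 0.
Proof.
move=> lowp lt_md; apply/eqP; rewrite mcoeff_eq0; apply: contraL lt_md => /lowp.
by rewrite -leqNgt.
Qed.

Lemma lowD d p q : low d p -> low d q -> low d (p + q).
Proof.
move=> lowp lowq m /msuppD_le; rewrite mem_cat => /orP[]; [exact: lowp|exact: lowq].
Qed.

Lemma low0 d : low d 0.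
Proof. by move=> m; rewrite msupp0. Qed.

Lemma lowN d p : low d p -> low d (- p).
Proof. by move=> lowp m; rewrite (perm_mem (msuppN p)); apply: lowp. Qed.

Lemma lowM d p q : low d p -> low d (q * p).
Proof.
move=> lowp m /msuppM_le/allpairsP[[m1 m2] [_ /lowp le_d ->]].
by rewrite mdegD (leq_trans le_d) // leq_addl.
Qed.

Lemma lowX d m : (d <= mdeg m)%N -> low d 'X_[m].
Proof. by move=> le_dm m'; rewrite msuppX inE => /eqP->. Qed.

Lemma low_alternant d p : low d p -> low d (alternant p).
Proof.
move=> lowp; rewrite /alternant; elim/big_ind: _ => [||s _]; [exact: low0|exact: lowD|].
apply: lowM => m; rewrite mcoeff_msupp mcoeff_sym -mcoeff_msupp => /lowp.
by rewrite mdeg_mperm.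
Qed.

(** The monomial order refines the degree, so that [mlast] picks a term of least
    degree; in a domain the last terms of two factors multiply without
    cancellation. *)
Lemma mcoeffM_mlast p q :
  (p * q)@_(mlast p + mlast q) = p@_(mlast p) * q@_(mlast q).
Proof.
have ltS : (mdeg (mlast p) < (mdeg (mlast p + mlast q)%MM).+1)%N.
  by rewrite ltnS mdegD leq_addr.
have ltS' : (mdeg (mlast q) < (mdeg (mlast p + mlast q)%MM).+1)%N.
  by rewrite ltnS mdegD leq_addl.
rewrite mcoeffM (bigD1 (BMultinom ltS, BMultinom ltS')) //= big1 ?addr0 //.
move=> [[m1 lt1] [m2 lt2]] /= /andP[/eqP eqm ne].
case: (ltgtP m1 (mlast p)) => [/mcoeff_lt_mlast->|lt_pm|eq1]; first by rewrite mul0r.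
  rewrite (@mcoeff_lt_mlast _ _ q m2) ?mulr0 // ltNge; apply/negP => le_qm.
  by have := ltmc_le_add lt_pm le_qm; rewrite -eqm ltxx.
case/negP: ne; rewrite xpair_eqE -!val_eqE /= eq1 eqxx /=.
by move: eqm; rewrite eq1 => /addmI ->.
Qed.

Lemma low_divl d p q : q != 0 -> low (d + mdeg (mlast q)) (q * p) -> low d p.
Proof.
move=> q0 lowqp m m_in.
have p0 : p != 0 by apply: contraTneq m_in => ->; rewrite msupp0.
have: (d + mdeg (mlast q) <= mdeg (mlast q + mlast p)%MM)%N.
  apply: lowqp; rewrite mcoeff_msupp mcoeffM_mlast.
  by rewrite mulf_neq0 // -mcoeff_msupp mlast_supp.
rewrite mdegD addnC leq_add2l => /leq_trans; apply.
exact/lemc_mdeg/mlast_lemc.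
Qed.

(** Permuting the variables preserves the order of vanishing, and dividing by the
    Vandermonde product loses exactly its own order. *)
Lemma low_symmetrize d p : low (d + mdeg (mlast vdm)) p -> low d (symmetrize p).
Proof.
by move=> lowp; apply: low_divl vdm_neq0 _; rewrite -symmetrizeE; apply: low_alternant.
Qed.

End Alternants.

(** * Summing over a freely parametrized family of exponents *)

Lemma mul_mpoly_pseriesE (A : idomainType) (n : nat) (q p : {mpoly A[n]}) m :
  mul_mpoly_pseries q (fun m' => p@_m') m = (q * p)@_m.
Proof.
rewrite /mul_mpoly_pseries [in RHS](mpolyE q) mulr_suml raddf_sum /= big_mkcond /=.
apply: eq_bigr => j _; rewrite -scalerAl mcoeffZ ['X_[_] * p]mulrC.
case: ifPn => [le_jm|]; first by rewrite -[in RHS](submK le_jm) addmC mcoeffMX.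
move=> nle_jm; apply/esym/eqP; rewrite mulf_eq0; apply/orP; right.
rewrite mcoeff_eq0 (perm_mem (msuppMX p j)); apply: contra nle_jm.
by case/mapP=> m' _ ->; apply: lem_addr.
Qed.

Lemma is_expansion_mpoly (A : idomainType) (n : nat) (p : {mpoly A[n]}) :
  is_expansion (FracField.tofrac p) (fun m => p@_m).
Proof.
exists p, 1; split=> [||m]; last by rewrite mul_mpoly_pseriesE mul1r.
  by rewrite mcoeff1 eqxx oner_neq0.
by rewrite rmorph1 divr1.
Qed.

(** Both families of exponents of interest consist of the sequences
    k_i = c_i + sum_(j : i in S_j) a_j with a_1, ..., a_n arbitrary natural numbers.
    The monomial x^k is then x^c prod_j u_j^(a_j), where u_j is the product of the
    variables indexed by S_j, and the sum over a is a product of geometric series. *)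
Section FreeFamily.
Variables (A : idomainType) (n : nat) (M : {mpoly A[n]}).
Variables (c : 'I_n -> nat) (S : 'I_n -> {set 'I_n}).
Hypothesis S_neq0 : forall j, S j != set0.
Implicit Types (N d : nat) (s : 'S_n) (m : 'X_{1..n}) (a : 'I_n -> nat).

Definition base : 'X_{1..n} := [multinom c i | i < n].
Definition step (j : 'I_n) : 'X_{1..n} := [multinom nat_of_bool (i \in S j) | i < n].
Definition expo (a : 'I_n -> nat) : 'X_{1..n} :=
  [multinom (c i + \sum_(j | i \in S j) a j)%N | i < n].

Lemma expoE a : expo a = (base + \sum_j step j *+ a j)%MM.
Proof.
apply/mnmP => i; rewrite mnmDE !mnmE mnm_sumE; congr (_ + _)%N.
rewrite big_mkcond; apply: eq_bigr => j _; rewrite mulmnE mnmE.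
by case: (i \in S j); rewrite ?mul1n ?mul0n.
Qed.

Lemma mdeg_step j : (0 < mdeg (step j))%N.
Proof.
rewrite lt0n mdeg_eq0; have /set0Pn[i i_in] := S_neq0 j.
apply/eqP => /mnmP /(_ i); rewrite !mnmE i_in; discriminate.
Qed.

Lemma leq_mdeg_expo a j : (a j <= mdeg (expo a))%N.
Proof.
rewrite expoE mdegD mdeg_sum (bigD1 j) //= mdegMn.
apply: leq_trans (leq_addl _ _); apply: leq_trans (leq_addr _ _).
by rewrite leq_pmull // mdeg_step.
Qed.

Definition geomden : {mpoly A[n]} := \prod_j (1 - 'X_[step j]).

(** Multiplying over all permutations makes the denominator symmetric, so that it can
    be moved across [symmetrize]. *)
Definition symden : {mpoly A[n]} := \prod_(s : 'S_n) msym s geomden.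
Definition codens : {mpoly A[n]} := \prod_(s : 'S_n | s != 1%g) msym s geomden.
Definition symnum : {mpoly A[n]} := symmetrize (M * 'X_[base] * codens).

(** Partial sums are taken over the boxes a_1, ..., a_n < N, on which the geometric
    series factor. *)
Definition partial N : {mpoly A[n]} :=
  \sum_(b : {ffun 'I_n -> 'I_N}) symmetrize (M * 'X_[expo (fun j => b j)]).

Lemma symdenE : symden = geomden * codens.
Proof. by rewrite /symden (bigD1 1%g) //= msym1m. Qed.

Lemma msym_symden s : msym s symden = symden.
Proof.
rewrite rmorph_prod [RHS](reindex_inj (mulIg s)) /=.
by apply: eq_bigr => t _; rewrite msymMm.
Qed.

Lemma mcoeff0_geomden : geomden@_0%MM = 1.
Proof.
rewrite rmorph_prod big1 // => j _ /=; rewrite mcoeffB mcoeff1 eqxx mcoeffX.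
by rewrite -mdeg_eq0 eqn0Ngt mdeg_step subr0.
Qed.

Lemma mcoeff0_symden : symden@_0%MM = 1.
Proof.
rewrite rmorph_prod big1 // => s _ /=; rewrite mcoeff_sym -[RHS]mcoeff0_geomden.
by congr mcoeff; apply/mnmP => i; rewrite !mnmE.
Qed.

Lemma symden_neq0 : symden != 0.
Proof. by apply: contra_eq_neq mcoeff0_symden => ->; rewrite mcoeff0 eq_sym oner_neq0. Qed.

Lemma geomden_box N :
  geomden * \sum_(b : {ffun 'I_n -> 'I_N}) 'X_[expo (fun j => b j)]
  = 'X_[base] * \prod_j (1 - 'X_[step j] ^+ N).
Proof.
have XE (b : {ffun 'I_n -> 'I_N}) :
    'X_[expo (fun j => b j)] = 'X_[base] * \prod_j 'X_[step j] ^+ b j :> {mpoly A[n]}.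
  by rewrite expoE mpolyXD -mprodXnE.
rewrite (eq_bigr _ (fun b _ => XE b)) -mulr_sumr mulrCA; congr (_ * _).
rewrite -(bigA_distr_bigA (fun j (i : 'I_N) => 'X_[step j] ^+ i)) -big_split /=.
by apply: eq_bigr => j _; rewrite -opprB mulNr -subrX1 opprB.
Qed.

Lemma low_box d N : (d <= N)%N -> low d (\prod_j (1 - 'X_[A, step j] ^+ N) - 1).
Proof.
move=> le_dN; elim/big_ind: _ => [|p q lowp lowq|j _].
- by rewrite subrr; apply: low0.
- have -> : p * q - 1 = p * (q - 1) + (p - 1) by rewrite mulrBr mulr1 addrA subrK.
  by apply: lowD => //; apply: lowM.
rewrite addrAC subrr add0r; apply: lowN; rewrite mpolyXn; apply: lowX.
by rewrite mdegMn (leq_trans le_dN) // leq_pmull // mdeg_step.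
Qed.

Local Notation delay := (mdeg (mlast (vdm A n))).

(** The box sum of the geometric series differs from the full quotient by terms
    containing some u_j^N, which have order at least N; symmetrizing costs the order
    of the Vandermonde product. *)
Lemma low_partial d N :
  (d + delay <= N)%N -> low d (symden * partial N - symnum).
Proof.
move=> le_dN; have symmetrizeN p : symmetrize (- p) = - symmetrize p :> {mpoly A[n]}.
  by apply/eqP; rewrite -addr_eq0 -symmetrizeD addNr symmetrize0.
rewrite /partial -symmetrize_sum -symmetrize_symM; last exact: msym_symden.
rewrite -symmetrizeN -symmetrizeD; apply: low_symmetrize.
rewrite -mulr_sumr symdenE mulrCA mulrAC geomden_box.
have -> : M * ('X_[base] * \prod_j (1 - 'X_[step j] ^+ N) * codens)
          - M * 'X_[base] * codens
  = M * 'X_[base] * codens * (\prod_j (1 - 'X_[step j] ^+ N) - 1).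
  by rewrite mulrBr mulr1 -!mulrA [codens * _]mulrC.
exact/lowM/low_box.
Qed.

(** Both partial sums agree with the same quotient up to high order once multiplied
    by [symden], which has order 0. *)
Lemma partial_stable m N N' : (mdeg m + delay < N)%N -> (mdeg m + delay < N')%N ->
  (partial N)@_m = (partial N')@_m.
Proof.
move=> ltN ltN'; apply/eqP; rewrite -subr_eq0 -mcoeffB.
apply/eqP/(@low_coeff _ _ (mdeg m).+1) => //.
apply: (@low_divl _ _ _ _ symden); first exact: symden_neq0.
have -> : mdeg (mlast symden) = 0%N.
  apply/eqP; rewrite -leqn0 -(@mdeg0 n); apply/lemc_mdeg/mlast_lemc.
  by rewrite mcoeff_msupp mcoeff0_symden oner_neq0.
rewrite addn0 mulrBr -[X in X - _](subrK symnum) -addrA.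
apply: lowD; first exact: low_partial.
by rewrite -opprB; apply/lowN/low_partial.
Qed.

Variables (P : pred {ffun 'I_n -> int}) (r : {ffun 'I_n -> int} -> ratfun A n).

Definition kseq (a : {ffun 'I_n -> nat}) : {ffun 'I_n -> int} := [ffun i => (expo a i)%:Z].

Hypothesis kseq_inj : injective kseq.
Hypothesis kseqP : forall k, P k <-> exists a : {ffun 'I_n -> nat}, k = kseq a.
Hypothesis rE : forall a : {ffun 'I_n -> nat},
  r (kseq a) = FracField.tofrac (symmetrize (M * 'X_[expo a])).

(** If some a_j is at least N then x^k has degree at least N, so the box of a size just
    above m plus the order of the Vandermonde product contains all the exponents that
    contribute in degree m. *)
Theorem sum_kseq_expansion : sum_is_expansion_of P r
  (FracField.tofrac symnum / FracField.tofrac symden).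
Proof.
pose absm (k : {ffun 'I_n -> int}) : 'X_{1..n} := [multinom `|k i|%N | i < n].
have absmE (a : {ffun 'I_n -> nat}) : absm (kseq a) = expo a.
  by apply/mnmP => i; rewrite !mnmE ffunE absz_nat mnmE.
pose g k : pseries A n := fun m => (symmetrize (M * 'X_[absm k]))@_m.
pose bnd m := (mdeg m + delay).+1.
exists g, (fun m => (partial (bnd m))@_m); split.
- by move=> k /kseqP[a ->]; rewrite rE /g absmE; apply: is_expansion_mpoly.
- move=> m; pose toN (b : {ffun 'I_n -> 'I_(bnd m)}) := [ffun j => b j : nat].
  exists [seq kseq (toN b) | b <- enum {: {ffun 'I_n -> 'I_(bnd m)}}]; split.
  + rewrite map_inj_uniq ?enum_uniq // => b b' /kseq_inj /ffunP eq_b.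
    by apply/ffunP => j; apply: val_inj; have := eq_b j; rewrite !ffunE.
  + by move=> k /mapP[b _ ->]; apply/kseqP; exists (toN b).
  + move=> k /kseqP[a ->] a_notin; rewrite /g absmE.
    have [/forallP small|] := boolP [forall j, a j < bnd m]%N.
      case/mapP: a_notin; exists [ffun j => Ordinal (small j)]; first by rewrite mem_enum.
      by congr kseq; apply/ffunP => j; rewrite !ffunE.
    rewrite negb_forall => /existsP[j]; rewrite -leqNgt => le_aj.
    apply: (@low_coeff _ _ (mdeg m).+1) => //; apply/low_symmetrize/lowM/lowX.
    by rewrite addSn (leq_trans le_aj) // leq_mdeg_expo.
  rewrite big_map big_enum raddf_sum /=; apply: eq_bigr => b _; rewrite /g absmE.
  congr (symmetrize (M * 'X_[_]))@_m; apply/mnmP => i; rewrite !mnmE; congr addn.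
  by apply: eq_bigr => j _; rewrite ffunE.
exists symnum, symden; split=> [||m]; first by rewrite mcoeff0_symden oner_neq0.
  by [].
transitivity (symden * partial (bnd m))@_m.
  rewrite -mul_mpoly_pseriesE; apply: eq_bigr => j _; congr (_ * _).
  by apply: partial_stable; rewrite ltnS // leq_add2r mdegB.
apply/eqP; rewrite -subr_eq0 -mcoeffB; apply/eqP/(@low_coeff _ _ (mdeg m).+1) => //.
exact: low_partial.
Qed.

(** The value of the sum of the series as a symmetrization of rational functions.
    The point y must not be a zero of the denominators; requiring that no nonzero
    polynomial vanishes at y covers all of them at once. *)
Lemma mmap_symnum_symden (K : fieldType) (f : {rmorphism A -> K}) (y : 'I_n -> K) :
  (forall p, p != 0 -> mmap f y p != 0) ->
  mmap f y symnum / mmap f y symden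
  = \sum_(s : 'S_n) mmap f (y \o s) (M * 'X_[base]) / mmap f (y \o s) geomden
                    / vandermonde (y \o s).
Proof.
move=> y_free; have V0 : vandermonde y != 0.
  by rewrite -(mmap_vdm f); apply/y_free/vdm_neq0.
have -> : mmap f y symnum = mmap f y (alternant (M * 'X_[base] * codens)) / vandermonde y.
  by apply: (canRL (mulfK V0)); rewrite symmetrizeE mulrC rmorphM /= mmap_vdm.
rewrite rmorph_sum /= !mulr_suml; apply: eq_bigr => s _.
have free_s p : p != 0 -> mmap f (y \o s) p != 0.
  move=> p0; rewrite -mmap_msym; apply: y_free.
  by rewrite -(msym0 _ s) (inj_eq (@inj_msym _ _ s)).
rewrite rmorphM rmorph_sign /= mmap_msym -(msym_symden s) mmap_msym symdenE !rmorphM /=.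
rewrite vandermonde_perm !invfM invr_sign.
have cod0 : mmap f (y \o s) codens != 0.
  by apply: free_s; apply: contraNneq symden_neq0 => eq0; rewrite symdenE eq0 mulr0.
have cancel (e b v d t : K) : t != 0 -> e * (b * t) * v * (d * t^-1) = b * d * (e * v).
  move=> t0; transitivity (b * d * (e * v) * (t * t^-1)); first by ring.
  by rewrite mulfV // mulr1.
exact: cancel.
Qed.

End FreeFamily.

(** * Evaluating rational functions at the inverses of the variables *)

Section FractionField.
Variables (A : idomainType) (n : nat).

HB.instance Definition _ := GRing.RMorphism.copy (@ratC A n)
  (@FracField.tofrac {mpoly A[n]} \o @mpolyC n A).

Lemma tofrac_mmap (p : {mpoly A[n]}) :
  FracField.tofrac p = mmap (@ratC A n) (@ratX A n) p.
Proof. exact: (rmorph_mmap (@FracField.tofrac {mpoly A[n]})). Qed.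

Lemma mmap_ratX_neq0 (p : {mpoly A[n]}) : p != 0 -> mmap (@ratC A n) (@ratX A n) p != 0.
Proof. by rewrite -tofrac_mmap tofrac_eq0. Qed.

(** Up to a monomial factor, the value of p at the inverses of y is the value at y of
    the polynomial obtained from p by reversing all exponents. *)
Lemma mmap_inv_neq0 (K : fieldType) (f : {rmorphism A -> K}) (y : 'I_n -> K) :
  (forall p : {mpoly A[n]}, p != 0 -> mmap f y p != 0) ->
  forall p : {mpoly A[n]}, p != 0 -> mmap f (fun i => (y i)^-1) p != 0.
Proof.
move=> y_free p p0.
have y0 i : y i != 0.
  have: ('X_i : {mpoly A[n]}) != 0.
    apply/eqP => /mpolyP /(_ U_(i)%MM) /eqP; rewrite mcoeffXU eqxx mcoeff0.
    by rewrite oner_eq0.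
  by move/y_free; rewrite mmapX mmap1U.
pose N := msize p; pose top : 'X_{1..n} := [multinom N | i < n].
have le_top m : m \in msupp p -> (m <= top)%MM.
  move/msize_mdeg_lt => lt_mN; apply/mnm_lepP => i; rewrite mnmE.
  by apply: leq_trans (ltnW lt_mN); rewrite mdegE (bigD1 i) //= leq_addr.
pose q := \sum_(m <- msupp p) p@_m *: 'X_[top - m] : {mpoly A[n]}.
have q0 : q != 0.
  have m0_in : mlast p \in msupp p by apply: mlast_supp.
  apply/eqP => /mpolyP /(_ (top - mlast p)%MM).
  rewrite mcoeff0 raddf_sum /= (bigD1_seq _ m0_in) ?msupp_uniq //=.
  rewrite mcoeffZ mcoeffX eqxx mulr1 big_seq_cond big1 ?addr0.
    by move/eqP; apply/negP; rewrite -mcoeff_msupp.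
  move=> m /andP[m_in ne_m]; rewrite mcoeffZ mcoeffX.
  case: eqP => [eq_m|]; last by rewrite mulr0.
  case/eqP: ne_m; apply/mnmP => i.
  have /mnm_lepP /(_ i) le_m := le_top _ m_in.
  have /mnm_lepP /(_ i) le_m0 := le_top _ m0_in.
  by move/mnmP: eq_m => /(_ i); rewrite !mnmBE -{2}(subKn le_m) => ->; rewrite subKn.
have: mmap f y q != 0 by apply: y_free.
suff -> : mmap f y q = (\prod_i y i ^+ N) * mmap f (fun i => (y i)^-1) p.
  by rewrite mulf_eq0 negb_or => /andP[].
rewrite raddf_sum /= [X in _ * X]/mmap mulr_sumr big_seq [RHS]big_seq.
apply: eq_bigr => m /le_top /mnm_lepP le_m.
rewrite mmapZ mmapX [RHS]mulrCA; congr (_ * _); rewrite -big_split /=.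
rewrite /mmap1; apply: eq_bigr => i _; have := le_m i; rewrite mnmBE mnmE => le_mN.
by rewrite exprB ?unitfE // exprVn.
Qed.

Lemma tofrac_repr (F : ratfun A n) (r := generic_quotient.repr F) :
  F = FracField.tofrac \n_r / FracField.tofrac \d_r.
Proof.
have d0 : FracField.tofrac \d_r != 0 by rewrite tofrac_eq0 denom_ratioP.
apply: (canRL (mulfK d0)); rewrite {1}/r -[F in LHS]generic_quotient.reprK -/r.
unlock FracField.tofrac.
rewrite -[LHS]FracField.pi_mul; apply/eqmodP => /=.
rewrite FracField.equivfE /FracField.mulf !numden_Ratio ?mulf_neq0 ?oner_neq0 ?denom_ratioP //.
by rewrite !mulr1 /r generic_quotient.reprK mulrC.
Qed.

Lemma ratfun_substE (y : 'I_n -> ratfun A n) (p q : {mpoly A[n]}) :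
  (forall d : {mpoly A[n]}, d != 0 -> mmap (@ratC A n) y d != 0) -> q != 0 ->
  ratfun_subst (FracField.tofrac p / FracField.tofrac q) y
  = mmap (@ratC A n) y p / mmap (@ratC A n) y q.
Proof.
move=> y_free q0; rewrite /ratfun_subst; set F := (FracField.tofrac p / _).
have := tofrac_repr F; set r := generic_quotient.repr _.
have d0 : \d_r != 0 by apply: denom_ratioP.
move/eqP; rewrite {1}/F eqr_div ?tofrac_eq0 // -!tofracM tofrac_eq => /eqP eq_pq.
have := congr1 (mmap (@ratC A n) y) eq_pq; rewrite !rmorphM /= => eq_y.
by apply/eqP; rewrite eqr_div ?y_free // eq_y.
Qed.

End FractionField.

(** * Inverting the variables in one term of the symmetrization *)

Section Inversion.
Variables (K : fieldType) (n : nat) (w : K).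

(** The product over i < j in the Robbins polynomial at u = v = 1. *)
Definition kernel (R : comNzRingType) (w : R) (y : 'I_n -> R) : R :=
  \prod_(i < n) \prod_(j < n | (i < j)%N) (y i * y j + 1 + w * y i).

Lemma prod_pairs_rev (phi : 'I_n -> 'I_n -> K) :
  \prod_(i < n) \prod_(j < n | (i < j)%N) phi (rev_ord i) (rev_ord j)
  = \prod_(i < n) \prod_(j < n | (i < j)%N) phi j i.
Proof.
rewrite [RHS](exchange_big_dep predT) //= (reindex_inj rev_ord_inj) /=.
apply: eq_bigr => i _; rewrite (reindex_inj rev_ord_inj) /= rev_ordK.
apply: eq_big => [j|j _]; last by rewrite rev_ordK.
by have := ltn_ord i; have := ltn_ord j; lia.
Qed.

Lemma prod_tails (z : 'I_n -> K) :
  \prod_(j < n) \prod_(i < n | (j <= i)%N) z i = \prod_(i < n) z i ^+ i.+1.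
Proof.
rewrite (exchange_big_dep predT) //=; apply: eq_bigr => i _.
rewrite prodr_const -sum1_card; congr (_ ^+ _).
rewrite (eq_bigl (fun j : 'I_n => (j < i.+1)%N)) //.
by rewrite (big_ord_narrow (ltn_ord i)) sum1_card card_ord.
Qed.

Definition incr_term (y : 'I_n -> K) : K :=
  kernel w y * (\prod_i y i ^+ i) / \prod_(j < n) (1 - \prod_(i < n | (j <= i)%N) y i)
  / vandermonde y.

Definition decr_term (y : 'I_n -> K) : K :=
  kernel w y / \prod_(j < n) (1 - \prod_(i < n | (j <= rev_ord i)%N) y i)
  / vandermonde y.

(** [kernel] and [vandermonde] both produce the factor prod_(i<j) 1 / (z_i z_j), which
    cancels.  With
    U_j = z_j ... z_n, the denominators contribute (-1)^n prod_j U_j, that is,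
    (-1)^n prod_i z_i^i with indices from 1; multiplied by the numerator monomial
    prod_i z_i^(-(i-1)) this leaves (-1)^n prod_i z_i. *)
Lemma incr_term_inv (z : 'I_n -> K) : (forall i, z i != 0) ->
  incr_term (fun i => (z i)^-1)
  = (-1) ^+ n * (\prod_i z i) * decr_term (z \o @rev_ord n).
Proof.
move=> z0; rewrite /incr_term /decr_term.
pose B := \prod_(i < n) \prod_(j < n | (i < j)%N) (z i * z j).
have B0 : B != 0.
  by apply/prodf_neq0 => i _; apply/prodf_neq0 => j _; rewrite mulf_neq0.
have -> : kernel w (fun i => (z i)^-1) = kernel w (z \o @rev_ord n) / B.
  rewrite /kernel (prod_pairs_rev (fun i j => z i * z j + 1 + w * z i)) -prodf_div.
  apply: eq_bigr => i _; rewrite -prodf_div; apply: eq_bigr => j _.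
  by field; rewrite !z0.
have -> : vandermonde (fun i => (z i)^-1) = vandermonde (z \o @rev_ord n) / B.
  rewrite /vandermonde (prod_pairs_rev (fun i j => z j - z i)) -prodf_div.
  apply: eq_bigr => i _; rewrite -prodf_div; apply: eq_bigr => j _.
  by field; rewrite !z0.
pose U j := \prod_(i < n | (j <= i)%N) z i.
have U0 j : U j != 0 by apply/prodf_neq0.
have tailsV : \prod_(j < n) (1 - \prod_(i < n | (j <= i)%N) (z i)^-1)
    = (-1) ^+ n * \prod_(j < n) (1 - U j) / \prod_(i < n) z i ^+ i.+1.
  rewrite -prod_tails -[in (-1) ^+ n](card_ord n) -prodr_const -big_split -prodf_div /=.
  by apply: eq_bigr => j _; rewrite prodfV -/(U j); field.
have -> : \prod_(j < n) (1 - \prod_(i < n | (j <= rev_ord i)%N) (z \o @rev_ord n) i)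
    = \prod_(j < n) (1 - U j).
  by apply: eq_bigr => j _; rewrite /U [in RHS](reindex_inj rev_ord_inj).
have -> : \prod_(i < n) (z i)^-1 ^+ i = \prod_(i < n) z i / \prod_(i < n) z i ^+ i.+1.
  by rewrite -prodf_div; apply: eq_bigr => i _; rewrite exprS exprVn invfM mulrA mulfV ?mul1r.
have P0 : \prod_(i < n) z i ^+ i.+1 != 0.
  by apply/prodf_neq0 => i _; apply: expf_neq0.
have cancel (e k v p d t b : K) : t != 0 -> b != 0 ->
    k * b^-1 * (p * t^-1) * (e * d * t) * (v * b) = e * p * (k * d * v).
  move=> t0 b0; transitivity (e * p * (k * d * v) * (b * b^-1) * (t * t^-1)); first by ring.
  by rewrite !mulfV // !mulr1.
by rewrite tailsV !invfM !invrK -signr_odd invr_sign cancel.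
Qed.

End Inversion.

(** * Monotone sequences as sequences of partial sums *)

Section PartialSums.
Variable n : nat.
Implicit Types (a b : 'I_n -> nat) (i j : 'I_n).

Lemma psumS a i :
  (\sum_(j < n | j <= i) a j = a i + \sum_(j < n | j < i) a j)%N.
Proof.
rewrite (bigD1 i) //=; congr addn; apply: eq_bigl => j.
by rewrite ltn_neqAle andbC.
Qed.

Lemma psum_inj a b :
  (forall i, \sum_(j < n | j <= i) a j = \sum_(j < n | j <= i) b j)%N -> a =1 b.
Proof.
move=> eq_ab; have eq_lt m : (m <= n)%N ->
    (\sum_(j < n | j < m) a j = \sum_(j < n | j < m) b j)%N.
  case: m => [|m] lt_mn; first by rewrite !big_pred0.
  exact: (eq_ab (Ordinal lt_mn)).
move=> i; have := eq_ab i; rewrite !psumS.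
by rewrite (eq_lt i) 1?ltnW // => /addIn.
Qed.

Lemma leq_psum a i j : (i <= j)%N ->
  (\sum_(l < n | l <= i) a l <= \sum_(l < n | l <= j) a l)%N.
Proof.
move=> le_ij; rewrite big_mkcond [leqRHS]big_mkcond; apply: leq_sum => l _.
by case: (leqP l i) => // le_li; rewrite (leq_trans le_li le_ij).
Qed.

(** The increments are the differences between k_i and the largest k_j + delta with
    j < i, the latter being 0 when i is the first index. *)
Lemma psum_of_increasing (delta : nat) (k : 'I_n -> nat) :
  (forall i j, (i < j)%N -> k i + delta <= k j)%N ->
  exists a : {ffun 'I_n -> nat}, forall i, (k i = delta * i + \sum_(j < n | j <= i) a j)%N.
Proof.
move=> k_incr; pose top (m : nat) := \max_(i < n | (i < m)%N) (k i + delta)%N.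
have le_top i : (top i <= k i)%N by apply/bigmax_leqP => j; apply: k_incr.
have topS i : top i.+1 = (k i + delta)%N.
  apply/eqP; rewrite eqn_leq; apply/andP; split; last exact: (leq_bigmax_cond i).
  apply/bigmax_leqP => j; rewrite ltnS leq_eqVlt => /orP[/eqP/val_inj-> //|lt_ji].
  by rewrite leq_add2r (leq_trans (leq_addr delta _)) ?k_incr.
pose a := [ffun i : 'I_n => (k i - top i)%N]; exists a.
have topE m : (m <= n)%N -> top m = (delta * m + \sum_(j < n | j < m) a j)%N.
  elim: m => [|m IHm] lt_mn; first by rewrite /top !big_pred0 ?muln0.
  have := le_top (Ordinal lt_mn); have := topS (Ordinal lt_mn).
  have : (\sum_(j < n | j < m.+1) a j = _)%N := psumS a (Ordinal lt_mn).
  by rewrite ffunE (IHm (ltnW lt_mn)) /= => -> ->; nia.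
move=> i; have := topE i.+1 (ltn_ord i); rewrite topS mulnS.
by rewrite addnC -addnA => /addnI.
Qed.

End PartialSums.

(** * The two families of Robbins polynomials *)

Section Robbins.
Variables (A : idomainType) (n : nat) (w : A).

Definition mkernel : {mpoly A[n]} := kernel w%:MP (fun i => 'X_i).

Lemma mmap_kernel (K : comNzRingType) (f : {rmorphism A -> K}) (y : 'I_n -> K) :
  mmap f y mkernel = kernel (f w) y.
Proof.
rewrite rmorph_prod; apply: eq_bigr => i _; rewrite rmorph_prod; apply: eq_bigr => j _ /=.
by rewrite !rmorphD !rmorphM rmorph1 /= mmapC !mmapX !mmap1U.
Qed.

Lemma mmap_geomden (K : comNzRingType) (f : {rmorphism A -> K}) (y : 'I_n -> K) S :
  mmap f y (geomden A S) = \prod_j (1 - \prod_(i in S j) y i).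
Proof.
rewrite rmorph_prod; apply: eq_bigr => j _; rewrite rmorphB rmorph1 /= mmapX.
congr (_ - _); rewrite [RHS]big_mkcond; apply: eq_bigr => i _; rewrite mnmE.
by case: (i \in S j).
Qed.

(** On nonnegative exponents the defining quotient is a polynomial. *)
Lemma robbins_kseq (c : 'I_n -> nat) S (a : {ffun 'I_n -> nat}) :
  robbins (kseq c S a) (@ratX A n) 1 1 (ratC n w)
  = FracField.tofrac (symmetrize (mkernel * 'X_[expo c S a])).
Proof.
have V0 : vandermonde (@ratX A n) != 0.
  by rewrite -(mmap_vdm (@ratC A n)); apply/mmap_ratX_neq0/vdm_neq0.
rewrite /robbins -/(vandermonde _); apply: (canLR (mulfK V0)).
rewrite -(mmap_vdm (@ratC A n)) -tofrac_mmap -rmorphM /= mulrC -symmetrizeE.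
rewrite tofrac_mmap rmorph_sum /=; apply: eq_bigr => s _.
rewrite rmorphM rmorph_sign /= mmap_msym rmorphM /= mmap_kernel mmapX.
congr (_ * (_ * _)); last by apply: eq_bigr => i _; rewrite ffunE.
by apply: eq_bigr => i _; apply: eq_bigr => j _; rewrite !mul1r.
Qed.

End Robbins.

Section Families.
Variable n : nat.

Definition tail_from (i : 'I_n) : {set 'I_n} := [set j : 'I_n | (i <= j)%N].
(** Indexing by the reversal makes the initial segments appear in decreasing order, so
    that the reversal of the variables carries the product attached to this set to the
    product attached to [tail_from i]. *)
Definition rev_tail_from (i : 'I_n) : {set 'I_n} := [set j : 'I_n | (i <= rev_ord j)%N].

Lemma tail_from_neq0 i : tail_from i != set0.
Proof. by apply/set0Pn; exists i; rewrite inE. Qed.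

Lemma rev_tail_from_neq0 i : rev_tail_from i != set0.
Proof. by apply/set0Pn; exists (rev_ord i); rewrite inE rev_ordK. Qed.

Definition incr_kseq := kseq (fun i : 'I_n => i) tail_from.
Definition decr_kseq := kseq (fun _ : 'I_n => 0%N) rev_tail_from.

Lemma incr_kseqE a i : incr_kseq a i = (i + \sum_(j < n | j <= i) a j)%N%:Z.
Proof. by rewrite ffunE mnmE; congr (_ + _)%N%:Z; apply: eq_bigl => j; rewrite inE. Qed.

Lemma decr_kseqE a i :
  decr_kseq a (rev_ord i) = (\sum_(j < n | j <= i) a j)%N%:Z.
Proof.
rewrite ffunE mnmE add0n; congr (Posz _); apply: eq_bigl => j.
by rewrite inE rev_ordK.
Qed.

Lemma incr_kseq_inj : injective incr_kseq.
Proof.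
move=> a b /ffunP eq_ab; apply/ffunP/psum_inj => i.
by have := eq_ab i; rewrite !incr_kseqE => -[/addnI].
Qed.

Lemma decr_kseq_inj : injective decr_kseq.
Proof.
move=> a b /ffunP eq_ab; apply/ffunP/psum_inj => i.
by have := eq_ab (rev_ord i); rewrite !decr_kseqE => -[].
Qed.

Lemma incr_kseqP k : strict_incr_nonneg k <-> exists a, k = incr_kseq a.
Proof.
split=> [/andP[/forallP k0 /forallP k_incr] | [a ->]].
  have [i j lt_ij|a ka] := @psum_of_increasing n 1 (fun i => `|k i|%N).
    rewrite addn1 -ltz_nat !gez0_abs //.
    by have /forallP /(_ j) /implyP := k_incr i; apply.
  exists a; apply/ffunP => i; rewrite incr_kseqE -[LHS]gez0_abs // ka.
  by rewrite mul1n.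
apply/andP; split; apply/forallP => i; first by rewrite incr_kseqE.
apply/forallP => j; apply/implyP => lt_ij; rewrite !incr_kseqE ltz_nat.
by rewrite -addSn leq_add // leq_psum // ltnW.
Qed.

Lemma decr_kseqP k : weak_decr_nonneg k <-> exists a, k = decr_kseq a.
Proof.
have rev_lt (i j : 'I_n) : (rev_ord i < rev_ord j)%N = (j < i)%N.
  by have := ltn_ord i; have := ltn_ord j; rewrite /=; lia.
split=> [/andP[/forallP k0 /forallP k_decr] | [a ->]].
  have [i j lt_ij|a ka] := @psum_of_increasing n 0 (fun i => `|k (rev_ord i)|%N).
    rewrite addn0 -lez_nat !gez0_abs //.
    by have /forallP /(_ (rev_ord i)) /implyP := k_decr (rev_ord j); rewrite rev_lt; apply.
  exists a; apply/ffunP => i; rewrite -(rev_ordK i) decr_kseqE -[LHS]gez0_abs // ka.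
  by rewrite mul0n.
apply/andP; split; apply/forallP => i; rewrite -[i]rev_ordK; first by rewrite decr_kseqE.
apply/forallP => j; rewrite -[j]rev_ordK rev_lt; apply/implyP => lt_ij.
by rewrite !decr_kseqE lez_nat leq_psum // ltnW.
Qed.

End Families.

Section Values.
Variables (A : idomainType) (n : nat) (w : A).
Variables (K : fieldType) (f : {rmorphism A -> K}) (y : 'I_n -> K).
Hypothesis y_free : forall p : {mpoly A[n]}, p != 0 -> mmap f y p != 0.

Definition incr_num := symnum (mkernel n w) (fun i : 'I_n => i) (@tail_from n).
Definition incr_den := symden A (@tail_from n).
Definition decr_num := symnum (mkernel n w) (fun _ : 'I_n => 0%N) (@rev_tail_from n).
Definition decr_den := symden A (@rev_tail_from n).

Lemma incr_value :
  mmap f y incr_num / mmap f y incr_den = \sum_(s : 'S_n) incr_term (f w) (y \o s).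
Proof.
rewrite mmap_symnum_symden //; last exact: tail_from_neq0.
apply: eq_bigr => s _; rewrite rmorphM /= mmap_kernel mmap_geomden mmapX /incr_term.
congr (_ * _ / _ / _); first by apply: eq_bigr => i _; rewrite mnmE.
by apply: eq_bigr => j _; congr (_ - _); apply: eq_bigl => i; rewrite inE.
Qed.

Lemma decr_value :
  mmap f y decr_num / mmap f y decr_den = \sum_(s : 'S_n) decr_term (f w) (y \o s).
Proof.
rewrite mmap_symnum_symden //; last exact: rev_tail_from_neq0.
apply: eq_bigr => s _; rewrite rmorphM /= mmap_kernel mmap_geomden mmapX /decr_term.
rewrite [X in _ * X / _ / _]big1 ?mulr1; last by move=> i _; rewrite mnmE.
congr (_ / _ / _).
by apply: eq_bigr => j _; congr (_ - _); apply: eq_bigl => i; rewrite inE.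
Qed.

End Values.

(** Composing permutations with the order-reversing one permutes the terms. *)
Lemma sum_incr_term_inv (K : fieldType) (n : nat) (w : K) (x : 'I_n -> K) :
  (forall i, x i != 0) ->
  \sum_(s : 'S_n) incr_term w ((fun i => (x i)^-1) \o s)
  = (-1) ^+ n * (\prod_i x i) * \sum_(s : 'S_n) decr_term w (x \o s).
Proof.
move=> x0; pose t : 'S_n := perm (@rev_ord_inj n).
rewrite mulr_sumr [RHS](reindex_inj (mulgI t)) /=; apply: eq_bigr => s _.
rewrite (@incr_term_inv _ _ _ (x \o s)) => [|i]; last exact: x0.
rewrite [X in _ = _ * X * _](reindex_inj (@perm_inj _ s)); congr (_ * _).
have tE i : ((t * s)%g : 'S_n) i = s (rev_ord i) by rewrite permM permE.
rewrite /decr_term /kernel /vandermonde /=; congr (_ / _ / _).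
- by apply: eq_bigr => i _; apply: eq_bigr => j _; rewrite !tE.
- by apply: eq_bigr => i _; congr (_ - _); apply: eq_bigr => j _; rewrite tE.
by apply: eq_bigr => i _; apply: eq_bigr => j _; rewrite !tE.
Qed.

Theorem mainTheorem3 (n : nat) (hn : (0 < n)%N) :
  exists F G : ratfun {poly int} n,
    [/\ sum_is_expansion_of (@strict_incr_nonneg n) (@robbins11w n) F,
        sum_is_expansion_of (@weak_decr_nonneg n) (@robbins11w n) G
      & G = (-1) ^+ n * (\prod_(i < n) (ratX {poly int} i)^-1)
            * ratfun_subst F (fun i => (ratX {poly int} i)^-1)].
Proof.
pose w : {poly int} := 'X.
exists (FracField.tofrac (incr_num n w) / FracField.tofrac (incr_den {poly int} n)).
exists (FracField.tofrac (decr_num n w) / FracField.tofrac (decr_den {poly int} n)).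
split.
- apply: sum_kseq_expansion; [exact: tail_from_neq0 | exact: incr_kseq_inj | exact: incr_kseqP |].
  exact: robbins_kseq.
- apply: sum_kseq_expansion;
    [exact: rev_tail_from_neq0 | exact: decr_kseq_inj | exact: decr_kseqP |].
  exact: robbins_kseq.
have x_free := @mmap_ratX_neq0 {poly int} n; have xV_free := mmap_inv_neq0 x_free.
have x0 i : ratX {poly int} i != 0 :> ratfun {poly int} n.
  rewrite tofrac_eq0; apply/eqP => /mpolyP /(_ U_(i)%MM) /eqP.
  by rewrite mcoeffXU eqxx mcoeff0 oner_eq0.
rewrite ratfun_substE //; last exact/symden_neq0/tail_from_neq0.
rewrite (incr_value w xV_free) (sum_incr_term_inv _ x0).
rewrite !tofrac_mmap (decr_value w x_free).
rewrite prodfV; set p := \prod_i _; set v := \sum_s _.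
have p0 : p != 0 by apply/prodf_neq0.
by rewrite mulrA mulrACA -expr2 sqrr_sign mul1r mulVf // mul1r.
Qed.
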